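(* Let $A\in\mathbb{R}^{N\times N}$ be symmetric and $B\in\{0,1\}^{N\times M}$, and let $\mathcal{C}_1,\dots,\mathcal{C}_K$ be the orbits of $\mathrm{aut}(\mathcal{G}(A,B))$ on $\{1,\dots,N\}$. If there exists a permutation matrix $P\neq I$ such that $PA=AP$ and $PB=B$, then the $A$-invariant subspace $$\mathcal{X}_{or}:=\{x\in\mathbb{R}^N:\ x_i=x_l\ \ \forall\, i,l\in\mathcal{C}_j,\ \forall j\}$$ contains the controllable subspace of the pair $(A,B)$.
   Context: $\mathrm{aut}(\mathcal{G}(A,B))$ is the group of $N\times N$ permutation matrices $P$ with $PA=AP$ and $PB=B$, acting on the node set $\{1,\dots,N\}$; its orbits (clusters) $\mathcal{C}_1,\dots,\mathcal{C}_K$ partition the nodes. The network dynamics is $\dot x=Ax+Bu$, with $B_{ij}=1$ if the $j$-th input is injected in node $i$ and $B_{ij}=0$ otherwise. The controllable subspace of $(A,B)$ is the smallest $A$-invariant subspace of $\mathbb{R}^N$ containing the range of $B$. $\mathcal{X}_{or}$ is called the group consensus subspace. *)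

(* Defs.v *)
From mathcomp Require Import all_boot all_order all_fingroup all_algebra.
From mathcomp Require Import boolp reals.

Set Implicit Arguments.
Unset Strict Implicit.
Unset Printing Implicit Defensive.

Import GroupScope GRing.Theory.
Local Open Scope ring_scope.

Section NetworkControl.
Variables (R : realType) (N M : nat).
Implicit Types (A : 'M[R]_N) (B : 'M[R]_(N, M)) (V W : {vspace 'cV[R]_N}).

(* aut(G(A,B)), encoded through the group isomorphism s |-> perm_mx s from
   'S_N onto the N x N permutation matrices (perm_mxM). *)
Definition aut_graph A B : {set 'S_N} :=
  [set s : 'S_N | (perm_mx s *m A == A *m perm_mx s) &&
                  (perm_mx s *m B == B)].

Lemma aut_graph_group_set A B : group_set (aut_graph A B).
Proof.
apply/group_setP; split=> [|s t]; rewrite !inE.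
  by rewrite perm_mx1 !mul1mx mulmx1 !eqxx.
move=> /andP[/eqP sA /eqP sB] /andP[/eqP tA /eqP tB].
by rewrite perm_mxM -!mulmxA tA tB sB mulmxA sA -mulmxA !eqxx.
Qed.

Canonical aut_graph_group A B := Group (aut_graph_group_set A B).

Definition clusters A B : {set {set 'I_N}} :=
  [set orbit 'P (aut_graph A B) i | i : 'I_N].

Definition group_consensus_subspace A B : {vspace 'cV[R]_N} :=
  (\bigcap_(C in clusters A B) \bigcap_(i in C) \bigcap_(l in C)
     lker (linfun (row i : 'cV[R]_N -> 'rV[R]_1) -
           linfun (row l : 'cV[R]_N -> 'rV[R]_1)))%VS.

Lemma group_consensus_subspaceP A B (x : 'cV[R]_N) :
  x \in group_consensus_subspace A B <->
  (forall C, C \in clusters A B ->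
   forall i l, i \in C -> l \in C -> x i 0 = x l 0).
Proof.
have memcap (I : finType) (P : pred I) (F : I -> {vspace 'cV[R]_N}) :
    x \in (\bigcap_(k | P k) F k)%VS <-> (forall k, P k -> x \in F k).
  by rewrite memvE; split=> [/subv_bigcapP | h]; last apply/subv_bigcapP.
have lkE i l : (x \in lker (linfun (row i : 'cV[R]_N -> 'rV[R]_1) -
    linfun (row l : 'cV[R]_N -> 'rV[R]_1))%VF) <-> (x i 0 = x l 0).
  rewrite memv_ker !lfun_simp /= subr_eq0; split.
    by move=> /eqP/matrixP/(_ 0 0); rewrite !mxE.
  by move=> xil; apply/eqP/matrixP=> a b; rewrite !mxE !ord1.
split=> [/memcap xX C CC i l iC lC | h].
  by move/memcap: (xX C CC) => /(_ i iC)/memcap/(_ l lC)/lkE.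
by apply/memcap=> C CC; apply/memcap=> i iC; apply/memcap=> l lC;
  apply/lkE; apply: h CC _ _ iC lC.
Qed.

Definition mx_invariant A V : bool :=
  (linfun (mulmx A : 'cV[R]_N -> 'cV[R]_N) @: V <= V)%VS.

Definition range_mx B : {vspace 'cV[R]_N} :=
  limg (linfun (mulmx B : 'cV[R]_M -> 'cV[R]_N)).

Definition is_controllable_subspace A B V : Prop :=
  [/\ mx_invariant A V, (range_mx B <= V)%VS &
      forall W, mx_invariant A W -> (range_mx B <= W)%VS -> (V <= W)%VS].

Lemma controllable_subspace_exists A B :
  exists V, is_controllable_subspace A B V.
Proof.
pose P n := `[< exists V, [/\ mx_invariant A V, (range_mx B <= V)%VS & \dim V = n] >].
have exP : exists n, P n.
  exists (\dim {: 'cV[R]_N}); apply/asboolP; exists fullv.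
  by rewrite /mx_invariant !subvf.
case: (ex_minnP exP) => n /asboolP[V [AV BV <-]] minV.
exists V; split=> // W AW BW.
have capV : P (\dim (V :&: W)).
  apply/asboolP; exists (V :&: W)%VS; split=> //; last by rewrite subv_cap BV.
  rewrite /mx_invariant subv_cap.
  rewrite (subv_trans (limgS _ (capvSl _ _)) AV).
  by rewrite (subv_trans (limgS _ (capvSr _ _)) AW).
have /eqP <- : (V :&: W)%VS == V by rewrite eqEdim capvSl minV.
exact: capvSr.
Qed.

Definition controllable_subspace A B : {vspace 'cV[R]_N} :=
  projT1 (cid (controllable_subspace_exists A B)).

Lemma controllable_subspaceP A B :
  is_controllable_subspace A B (controllable_subspace A B).
Proof. exact: projT2 (cid _). Qed.

End NetworkControl.

(* Main.v *)
Require Import Defs.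
From mathcomp Require Import all_boot all_order all_fingroup all_algebra.
From mathcomp Require Import boolp reals.

Import GRing.Theory.
Local Open Scope ring_scope.

(** A vector is constant on the orbits of the automorphism group exactly when
    it is fixed by every automorphism ([group_consensusP]); the consensus
    subspace is therefore a space of fixed vectors.  A linear map that commutes
    with the automorphisms preserves their fixed vectors, so [A] leaves this
    space invariant.  The equations [P *m B = B] say that the automorphisms fix
    the columns of [B], hence every vector [B *m u].  So the consensus subspace
    is one of the [A]-invariant subspaces that contain the range of [B], and the
    controllable subspace is the smallest of these. *)

Lemma perm_mx_fixP (R : pzSemiRingType) (n : nat) (s : 'S_n) (x : 'cV[R]_n) :
  perm_mx s *m x = x <-> forall i, x (s i) 0 = x i 0.
Proof.
rewrite -row_permE; split=> [sx i | sx].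
  by rewrite -[in RHS]sx mxE.
by apply/matrixP=> i j; rewrite ord1 mxE sx.
Qed.

Section Consensus.
Context {R : realType} {N M : nat}.
Implicit Types (A : 'M[R]_N) (B : 'M[R]_(N, M)) (x : 'cV[R]_N).

Lemma aut_graphP A B (s : 'S_N) :
  reflect (perm_mx s *m A = A *m perm_mx s /\ perm_mx s *m B = B)
          (s \in aut_graph A B).
Proof.
by rewrite inE; apply: (iffP andP) => -[sA sB]; split; apply/eqP.
Qed.

(** Two nodes lie in a common orbit precisely when an automorphism moves one to
    the other, so equality along orbits can be tested one automorphism at a
    time. *)
Lemma group_consensusP A B x :
  x \in group_consensus_subspace A B <->
  (forall s, s \in aut_graph A B -> perm_mx s *m x = x).
Proof.
rewrite group_consensus_subspaceP; split=> [xC s sG | xfix C].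
  apply/perm_mx_fixP => i.
  have iC : orbit 'P (aut_graph A B) i \in clusters A B by exact: imset_f.
  apply: xC iC _ _ _ _; first exact: mem_orbit.
  exact: (orbit_refl _ (aut_graph_group A B)).
move=> /imsetP[k _ ->] i l /orbitP[s sG <-] /orbitP[t tG <-].
move/perm_mx_fixP: (xfix s sG) => sx; move/perm_mx_fixP: (xfix t tG) => tx.
by rewrite /= /aperm sx tx.
Qed.

Lemma group_consensus_invariant A B :
  mx_invariant A (group_consensus_subspace A B).
Proof.
apply/subvP=> _ /memv_imgP[x /group_consensusP xfix ->].
rewrite lfunE /=; apply/group_consensusP=> s sG.
have [sA _] := aut_graphP A B s sG.
by rewrite mulmxA sA -mulmxA xfix.
Qed.

Lemma range_sub_group_consensus A B :
  (range_mx B <= group_consensus_subspace A B)%VS.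
Proof.
apply/subvP=> _ /memv_imgP[u _ ->].
rewrite lfunE /=; apply/group_consensusP=> s sG.
have [_ sB] := aut_graphP A B s sG.
by rewrite mulmxA sB.
Qed.

End Consensus.

Theorem theorem2 (R : realType) (N M : nat)
    (A : 'M[R]_N) (B : 'M[R]_(N, M))
    (A_sym : A^T = A)
    (B_01 : forall i j, B i j = 0 \/ B i j = 1)
    (nontrivial_sym : exists P : 'M[R]_N,
       [/\ is_perm_mx P, P <> 1%:M, P *m A = A *m P & P *m B = B]) :
  mx_invariant A (group_consensus_subspace A B) /\
  (controllable_subspace A B <= group_consensus_subspace A B)%VS.
Proof.
have Ainv := group_consensus_invariant A B.
have [_ _ min_ctrl] := controllable_subspaceP A B.
by split=> //; apply: min_ctrl => //; apply: range_sub_group_consensus.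
Qed.
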